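(* Let $S$ be a strong semilattice of completely simple semigroups, and let $S/\mathcal{R}=\mathcal{S}(Y, S_{\alpha}, \phi_{\alpha,\beta})$ be the decomposition of $S/\mathcal{R}$ into a strong semilattice of left zero semigroups. Then $S$ is weakly right noetherian if and only if the following conditions hold: (1) $Y$ is weakly noetherian; (2) each $S_{\alpha}$ is finite; (3) there exists a finite subsemilattice $Y_0$ of $Y$ with the following property: for each $\beta\in Y$, there exists $\alpha\in Y_0$ such that $\alpha\geq\beta$ and $\phi_{\alpha,\beta}$ is surjective.
   Context: A right ideal of a semigroup $S$ is a subset $I\subseteq S$ with $IS\subseteq I$; it is finitely generated if $I=X\cup XS$ for some finite $X\subseteq I$. A semigroup is weakly right noetherian if every right ideal of it is finitely generated; weakly left noetherian is dual; weakly noetherian means both. A semilattice is a commutative semigroup of idempotents, ordered by $\alpha\geq\beta\iff\alpha\beta=\beta$. Strong semilattice of semigroups: let $Y$ be a semilattice and $(T_\alpha)_{\alpha\in Y}$ a family of pairwise disjoint semigroups, with homomorphisms $\phi_{\alpha,\beta}:T_\alpha\to T_\beta$ for all $\alpha\geq\beta$ in $Y$, such that $\phi_{\alpha,\alpha}$ is the identity and $\phi_{\alpha,\beta}\phi_{\beta,\gamma}=\phi_{\alpha,\gamma}$ (maps written on the right) whenever $\alpha\geq\beta\geq\gamma$. Then $\mathcal{S}(Y,T_\alpha,\phi_{\alpha,\beta})$ denotes the semigroup $\bigcup_{\alpha\in Y}T_\alpha$ with multiplication $ab=(a\phi_{\alpha,\alpha\beta})(b\phi_{\beta,\alpha\beta})$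 for $a\in T_\alpha$, $b\in T_\beta$. A semigroup is completely simple if it has no proper (two-sided) ideals and contains minimal left and minimal right ideals (equivalently, it is isomorphic to a Rees matrix semigroup over a group). A left zero semigroup is one satisfying $xy=x$ for all $x,y$. Green's relation $\mathcal{R}$ on $S$: $a\,\mathcal{R}\,b\iff \{a\}\cup aS=\{b\}\cup bS$. If $S$ is a strong semilattice of completely simple semigroups over $Y$, then $\mathcal{R}$ is a congruence on $S$ and $S/\mathcal{R}$ is a strong semilattice of left zero semigroups over the same semilattice $Y$; its components are the images of the components of $S$, i.e. the quotients of the completely simple components by their own $\mathcal{R}$-relations, and its connecting homomorphisms are induced by those of $S$. This is the decomposition referred to in the claim. *)

(* Defs.v *)
From HB Require Import structures.
From mathcomp Require Import all_boot all_order.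
From mathcomp Require Import boolp classical_sets functions cardinality.

Set Implicit Arguments.
Unset Strict Implicit.
Unset Printing Implicit Defensive.

Import Order.Theory.
Import Algebra.
Local Open Scope quotient_scope.
Local Open Scope classical_set_scope.
Local Open Scope group_scope.

Section Ideals.
Variable S : semigroupType.
Implicit Types (I X : set S) (r : rel S).

Definition right_ideal I := forall x s, I x -> I (x * s).
Definition left_ideal I := forall x s, I x -> I (s * x).
Definition two_sided_ideal I := right_ideal I /\ left_ideal I.

Definition weakly_right_noetherian := forall I, right_ideal I ->
  exists X, [/\ finite_set X, X `<=` I &
    I = X `|` [set x * s | x in X & s in [set: S]]].

Definition weakly_left_noetherian := forall I, left_ideal I ->
  exists X, [/\ finite_set X, X `<=` I &
    I = X `|` [set s * x | s in [set: S] & x in X]].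

Definition weakly_noetherian :=
  weakly_right_noetherian /\ weakly_left_noetherian.

(* The empty set is an ideal for the definitions above, so it is excluded
   explicitly where simplicity and minimality are concerned. *)
Definition minimal_right_ideal I := [/\ right_ideal I, I !=set0 &
  forall J, right_ideal J -> J !=set0 -> J `<=` I -> J = I].
Definition minimal_left_ideal I := [/\ left_ideal I, I !=set0 &
  forall J, left_ideal J -> J !=set0 -> J `<=` I -> J = I].

Definition completely_simple :=
  [/\ forall I, two_sided_ideal I -> I !=set0 -> I = [set: S],
      exists I, minimal_left_ideal I & exists I, minimal_right_ideal I].

Definition left_zero := forall x y : S, x * y = x.

Definition principal_right (a : S) : set S :=
  [set a] `|` [set a * s | s in [set: S]].

Definition greenR : rel S :=
  fun a b => `[< principal_right a = principal_right b >].

Lemma greenR_refl : reflexive greenR. Proof. by move=> a; apply/asboolP. Qed.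

Lemma greenR_sym : symmetric greenR.
Proof. by move=> a b; apply/asboolP/asboolP => ->. Qed.

Lemma greenR_trans : transitive greenR.
Proof. by move=> b a c /asboolP ab /asboolP bc; apply/asboolP; rewrite ab. Qed.

Canonical greenR_equiv := EquivRel greenR greenR_refl greenR_sym greenR_trans.

Definition congruence r :=
  forall a b c d, r a b -> r c d -> r (a * c) (b * d).

Lemma principal_right_ideal a : right_ideal (principal_right a).
Proof.
move=> x s [->|[t _ <-]]; right; first by exists s.
by exists (t * s) => //; rewrite mulgA.
Qed.

Lemma greenRP a b :
  principal_right a b -> principal_right b a -> greenR a b.
Proof.
move=> ab ba; apply/asboolP; apply/seteqP; split => x [->//|[s _ <-]].
  exact: principal_right_ideal.
exact: principal_right_ideal.
Qed.

Lemma completely_simple_greenR_mul (cS : completely_simple) (x y : S) :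
  greenR (x * y) x.
Proof.
case: cS => simpS _ [M [rM [m0 Mm0] minM]].
pose U : set S := M `|` [set z | exists s m, M m /\ z = s * m].
have Ux : U x.
  suff -> : U = [set: S] by [].
  apply: simpS; last by exists m0; left.
  split=> z s [Mz|[t [m [Mm ->]]]].
  - by left; apply: rM.
  - by right; exists t, (m * s); split; [exact: rM|rewrite mulgA].
  - by right; exists s, z.
  - by right; exists (s * t), m; rewrite mulgA.
apply: greenRP; first last.
  by apply: principal_right_ideal; left.
case: Ux => [Mx|[s [m [Mm xE]]]].
  suff -> : principal_right (x * y) = M by [].
  apply: minM; first exact: principal_right_ideal.
    by exists (x * y); left.
  by move=> z [->|[t _ <-]]; [apply: rM|apply/rM/rM].
pose J : set S := [set n | M n /\ principal_right (x * y) (s * n)].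
suff JM : J = M by have [_] : J m by [rewrite JM]; rewrite -xE.
apply: minM.
- move=> n t [Mn xyn]; split; first exact: rM.
  by rewrite mulgA; apply: principal_right_ideal.
- by exists (m * y); split; [exact: rM|rewrite mulgA -xE; left].
- by move=> n [].
Qed.

Lemma completely_simple_greenR_congruence :
  completely_simple -> congruence greenR.
Proof.
move=> cS a b c e ab _.
have xyx := completely_simple_greenR_mul cS.
apply: greenR_trans (xyx a c) _; apply: greenR_trans ab _.
by rewrite greenR_sym.
Qed.

Lemma greenR_principal a b : greenR a b -> principal_right b a.
Proof. by move=> /asboolP <-; left. Qed.

End Ideals.

Section Quotient.
Variables (S : semigroupType) (r : equiv_rel S) (cr : congruence r).

Definition quotient (_ : congruence r) : Type := {eq_quot r}.
Local Notation Q := (quotient cr).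
HB.instance Definition _ := Choice.on Q.
HB.instance Definition _ := EqQuotient.on Q.

Definition quotient_mul (x y : Q) : Q := \pi_Q (repr x * repr y).

Lemma quotient_mul_pi x y : quotient_mul (\pi_Q x) (\pi_Q y) = \pi_Q (x * y).
Proof. by apply/eqquotP/cr; apply/(eqquotP Q); rewrite reprK. Qed.

Lemma quotient_mulA : associative quotient_mul.
Proof.
move=> x y z; rewrite -[x]reprK -[y]reprK -[z]reprK.
move: (repr x) (repr y) (repr z) => a b c.
rewrite (quotient_mul_pi b c) (quotient_mul_pi a b).
by rewrite (quotient_mul_pi a) (quotient_mul_pi (a * b)) mulgA.
Qed.

HB.instance Definition _ := isSemigroup.Build Q quotient_mulA.

Lemma piM x y : \pi_Q (x * y) = \pi_Q x * \pi_Q y.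
Proof. by rewrite [RHS]quotient_mul_pi. Qed.

End Quotient.

Lemma completely_simple_left_zero (S : semigroupType)
    (cS : completely_simple S) :
  left_zero (quotient (completely_simple_greenR_congruence cS)).
Proof.
move=> x y; rewrite -[x]reprK -[y]reprK.
move: (repr x) (repr y) => a b.
by rewrite -piM; apply/eqquotP; apply: completely_simple_greenR_mul.
Qed.

Lemma greenR_morph (S S' : semigroupType) (f : {multiplicative S -> S'}) a b :
  greenR a b -> greenR (f a) (f b).
Proof.
have fP u v : principal_right u v -> principal_right (f u) (f v).
  by move=> [->|[s _ <-]]; [left|right; exists (f s); rewrite ?gmulfM].
move=> ab; apply: greenRP; apply/fP/greenR_principal => //.
by rewrite greenR_sym.
Qed.

Section MeetSemigroup.
Context {d : Order.disp_t} (Y : meetSemilatticeType d).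

(* Y as a semigroup under meet; the library order on Y is then
   b <= a <-> a `&` b = b. *)
Definition meet_semigroup : Type := Y.
HB.instance Definition _ := Choice.on meet_semigroup.
HB.instance Definition _ :=
  isSemigroup.Build meet_semigroup (@meetA d Y).

Definition subsemilattice (A : set Y) :=
  forall a b, A a -> A b -> A (a `&` b)%O.

End MeetSemigroup.

Section StrongSemilattice.
Context {d : Order.disp_t} (Y : meetSemilatticeType d).

Record strong_semilattice := StrongSemilattice {
  component :> Y -> semigroupType;
  connecting : forall a b, (b <= a)%O ->
    {multiplicative component a -> component b};
  connect_id : forall a (aa : (a <= a)%O) x, connecting aa x = x;
  connect_comp : forall a b c (ba : (b <= a)%O) (cb : (c <= b)%O)
    (ca : (c <= a)%O) x, connecting cb (connecting ba x) = connecting ca x }.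

Section Union.
Variable T : strong_semilattice.

Definition strong_union : Type := {a : Y & T a}.
HB.instance Definition _ := Choice.on strong_union.

Definition inj a (x : T a) : strong_union := existT _ a x.

Definition union_mul (x y : strong_union) : strong_union :=
  inj (connecting T (leIl (tag x) (tag y)) (tagged x) *
       connecting T (leIr (tag y) (tag x)) (tagged y)).

Lemma union_eq a b (u : T a) (v : T b) : a = b ->
  (forall ba : (b <= a)%O, connecting T ba u = v) ->
  inj u = inj v.
Proof.
by move=> eab; case: b / eab v => v /(_ (lexx a)) <-; rewrite connect_id.
Qed.

Lemma union_eqE a b (u : T a) (v : T b) :
  inj u = inj v ->
  a = b /\ forall ba : (b <= a)%O, connecting T ba u = v.
Proof.
move=> uv; split; first exact: (congr1 (@tag Y _) uv).
have : forall w : strong_union, inj u = w ->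
    forall ba : (tag w <= a)%O, connecting T ba u = tagged w.
  by move=> w <- aa /=; rewrite connect_id.
by move=> /(_ _ uv).
Qed.

Lemma union_mulA : associative union_mul.
Proof.
move=> [a x] [b y] [c z]; apply: union_eq => /=; first exact: meetA.
move=> le; rewrite !gmulfM mulgA.
have connectE e f g (fe : (f <= e)%O) (gf : (g <= f)%O) u :
    connecting T gf (connecting T fe u) = connecting T (le_trans gf fe) u.
  exact: connect_comp.
rewrite !connectE; congr (_ * _ * _); congr (connecting T _ _);
  exact: bool_irrelevance.
Qed.

HB.instance Definition _ := isSemigroup.Build strong_union union_mulA.

End Union.

Section Decomposition.
Variables (T : strong_semilattice) (cT : forall a, completely_simple (T a)).

Definition R_component (a : Y) : semigroupType :=
  quotient (completely_simple_greenR_congruence (cT a)).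

Section Connect.
Variables (a b : Y) (ba : (b <= a)%O).

Definition R_connect (x : R_component a) : R_component b :=
  \pi_(R_component b) (connecting T ba (repr x)).

Lemma R_connect_pi (x : T a) :
  R_connect (\pi_(R_component a) x) = \pi_(R_component b) (connecting T ba x).
Proof.
by apply/eqquotP/greenR_morph; apply/(eqquotP (R_component a)); rewrite reprK.
Qed.

Lemma R_connectM : {morph R_connect : x y / x * y}.
Proof.
move=> x y; rewrite -[x]reprK -[y]reprK; move: (repr x) (repr y) => u v.
by rewrite -piM !R_connect_pi gmulfM piM.
Qed.

HB.instance Definition _ :=
  isMultiplicative.Build (R_component a) (R_component b) R_connect R_connectM.
End Connect.

Lemma R_connect_id a (aa : (a <= a)%O) x : R_connect aa x = x.
Proof.
by rewrite -[x]reprK; move: (repr x) => u; rewrite R_connect_pi connect_id.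
Qed.

Lemma R_connect_comp a b c (ba : (b <= a)%O) (cb : (c <= b)%O)
  (ca : (c <= a)%O) x : R_connect cb (R_connect ba x) = R_connect ca x.
Proof.
rewrite -[x]reprK; move: (repr x) => u.
rewrite (R_connect_pi ba u) (R_connect_pi cb) (R_connect_pi ca).
by rewrite (connect_comp ba cb ca).
Qed.

(* The strong semilattice decomposition of S/R for S = strong_union T; R_mapM
   and R_map_bij below show that its union is isomorphic to the quotient
   semigroup of S by greenR. *)
Definition R_decomposition : strong_semilattice :=
  @StrongSemilattice R_component
    (fun a b (ba : (b <= a)%O) => R_connect ba)
    R_connect_id R_connect_comp.

Lemma R_decomposition_left_zero a : left_zero (R_decomposition a).
Proof. exact: completely_simple_left_zero. Qed.

Lemma union_principal a b (u : T a) (v : T b) :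
  principal_right (inj u) (inj v) ->
  exists ba : (b <= a)%O, principal_right (connecting T ba u) v.
Proof.
move=> [/union_eqE[ab uv]|[[c w] _ /union_eqE[cE]]].
  have ab' : (a <= b)%O by rewrite ab.
  have ba : (b <= a)%O by rewrite ab.
  exists ba; left; rewrite -(uv ab') (connect_comp _ _ (lexx b)).
  by rewrite connect_id.
case: b / cE v => v /(_ (lexx _)) <-; exists (leIl a c); right.
by exists (connecting T (leIr c a) w); rewrite ?connect_id.
Qed.

Lemma principal_union a b (u : T a) (v : T b) (ba : (b <= a)%O) :
  principal_right (connecting T ba u) v -> principal_right (inj u) (inj v).
Proof.
set w := connecting T ba u.
have [s ws] : exists s, w * s = w.
  have ww := completely_simple_greenR_mul (cT b) w w.
  rewrite greenR_sym in ww.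
  have [e|[t _ e]] := greenR_principal ww; first by exists w.
  by exists (w * t); rewrite mulgA.
move=> pwv; have [t ->] : exists t, v = w * t.
  by case: pwv => [->|[t _ <-]]; [exists s|exists t].
right; exists (inj t) => //; apply: union_eq => [|le] /=.
  by apply/meet_idPr.
rewrite gmulfM; congr (_ * _); first exact: connect_comp.
by rewrite (connect_comp _ _ (lexx b)) connect_id.
Qed.

Lemma union_greenR a b (u : T a) (v : T b) :
  greenR (inj u) (inj v) <->
  a = b /\ forall ba : (b <= a)%O, greenR (connecting T ba u) v.
Proof.
split=> [uv|[ab]].
  have vu := uv; rewrite greenR_sym in vu.
  have [ab pvu] := union_principal (greenR_principal uv).
  have [ba puv] := union_principal (greenR_principal vu).
  have eab : a = b by apply/le_anti; rewrite ab ba.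
  split=> // ba'; apply: greenRP; first by rewrite (bool_irrelevance ba' ba).
  case: b / eab v {uv vu} ab pvu ba puv ba' => v ab pvu ba puv ba'.
  by move: pvu; rewrite !connect_id.
case: b / ab v => v /(_ (lexx a)); rewrite connect_id => uv.
apply: greenRP; apply: (principal_union (ba := lexx a)); rewrite connect_id;
  apply: greenR_principal => //.
by rewrite greenR_sym.
Qed.

Lemma union_greenR_congruence : congruence (@greenR (strong_union T)).
Proof.
move=> [a u] [b v] [c w] [e z] /union_greenR[ab] + /union_greenR[ce].
case: b / ab v => v /(_ (lexx a)); rewrite connect_id => uv.
case: e / ce z => z /(_ (lexx c)); rewrite connect_id => wz.
apply/union_greenR; split=> // ba; rewrite connect_id.
by apply: completely_simple_greenR_congruence (cT _) _ _ _ _ _ _;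
  apply: greenR_morph.
Qed.

Local Notation SR := (quotient union_greenR_congruence).

Definition R_map (q : strong_union R_decomposition) : SR :=
  \pi_SR (inj (repr (tagged q))).

Lemma R_map_pi a (u : T a) :
  R_map (inj (T := R_decomposition) (\pi_(R_component a) u)) = \pi_SR (inj u).
Proof.
apply/(eqquotP SR)/union_greenR; split=> // aa; rewrite connect_id.
by apply/(eqquotP (R_component a)); rewrite reprK.
Qed.

Lemma R_mapM : {morph R_map : x y / x * y}.
Proof.
move=> [a p] [b q].
have [u ->] : exists u, p = \pi_(R_component a) u by exists (repr p); rewrite reprK.
have [v ->] : exists v, q = \pi_(R_component b) v by exists (repr q); rewrite reprK.
rewrite (R_map_pi u) (R_map_pi v) -piM.
apply: etrans
  (R_map_pi (connecting T (leIl a b) u * connecting T (leIr b a) v)).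
congr R_map; apply: (congr1 (@inj R_decomposition _)).
by rewrite piM -!R_connect_pi.
Qed.

HB.instance Definition _ :=
  isMultiplicative.Build (strong_union R_decomposition) SR R_map R_mapM.

Lemma R_map_bij : bijective R_map.
Proof.
exists (fun q : SR => inj (T := R_decomposition)
  (\pi_(R_component (tag (repr q))) (tagged (repr q)))) => [[a p]|q].
  rewrite -[p]reprK; move: (repr p) => u {p}.
  rewrite (R_map_pi u).
  have : repr (\pi_SR (inj u)) = inj u %[mod SR] by rewrite reprK.
  case: (repr _) => b v /(eqquotP SR) /union_greenR[ba uv].
  case: a / ba u uv => u /(_ (lexx b)); rewrite connect_id => vu.
  by congr inj; apply/(eqquotP (R_component b)).
by rewrite R_map_pi -[RHS]reprK; case: (repr q).
Qed.

End Decomposition.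
End StrongSemilattice.

(* Main.v *)
Require Import Defs.
From mathcomp Require Import all_boot all_order.
From mathcomp Require Import boolp classical_sets functions cardinality.

(** Every right ideal of [S] is a union of R-classes, and [v] lies in the
    principal right ideal of [u] iff the class of [v] is the image of the class
    of [u] under a connecting map of [S/R].  So [S] is weakly right noetherian
    iff every down-set of the poset [S/R], ordered by [p >= q] iff [q] is the
    image of [p], is finitely generated.

    For necessity, apply this to preimages of ideals of [Y] (1), to the ideal
    generated by one component (2), whose top level needs all its elements as
    generators, and to [S] itself (3): let [Y0] be generated by the indices
    supporting the finite generating set, and given [b] take [a] to be the meet
    of those of them above [b].  Conversely, under (3) each class is the image
    of some [p] in one of the finitely many finite components over [Y0], and for
    fixed [p] the indices at which the image of [p] is in a given right ideal
    form an ideal of [Y], hence are finitely generated by (1). *)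

Import Order.Theory.
Import Algebra.
Local Open Scope quotient_scope.
Local Open Scope classical_set_scope.
Local Open Scope group_scope.

(** * Right ideals of a single semigroup *)

Lemma weakly_right_noetherianP (S : semigroupType) :
  weakly_right_noetherian S <->
  forall I : set S, right_ideal I -> exists X : set S,
    [/\ finite_set X, X `<=` I &
      forall z, I z -> exists2 x, X x & principal_right x z].
Proof.
split=> wn I rI; have [X [fX XI gX]] := wn I rI; exists X; split=> //.
  move=> z; rewrite gX => -[Xz|[x Xx [s _ <-]]]; first by exists z => //; left.
  by exists x => //; right; exists s.
apply/seteqP; split=> [z /gX [x Xx [->|[s _ <-]]]|z].
- by left.
- by right; exists x => //; exists s.
- by case=> [/XI//|[x /XI Ix [s _ <-]]]; apply: rI.
Qed.

Lemma right_ideal_principal {S : semigroupType} {I : set S} {x z : S} :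
  right_ideal I -> I x -> principal_right x z -> I z.
Proof. by move=> rI Ix [->//|[s _ <-]]; apply: rI. Qed.

Lemma completely_simple_inhabited {S : semigroupType} :
  completely_simple S -> exists x : S, True.
Proof. by case=> _ _ [I [_ [x _] _]]; exists x. Qed.

(** Principal right ideals of a completely simple semigroup are minimal, so containment between two
    of them is equality. *)
Lemma completely_simple_principal_greenR {S : semigroupType} (u v : S) :
  completely_simple S -> principal_right u v <-> greenR u v.
Proof.
move=> cS; split=> [[->|[s _ <-]]|uv]; first exact: greenR_refl.
  by rewrite greenR_sym; apply: completely_simple_greenR_mul.
by apply: greenR_principal; rewrite greenR_sym.
Qed.

(** * Ideals and finite meets in a semilattice *)

Section Semilattice.
Context {d : Order.disp_t} {Y : meetSemilatticeType d}.

Lemma meet_principalP (a b : meet_semigroup Y) :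
  principal_right a b <-> ((b : Y) <= (a : Y))%O.
Proof.
split=> [[->//|[s _ <-]]|ba]; first exact: leIl.
by right; exists b => //; apply/meet_idPr.
Qed.

Lemma meet_weakly_noetherian :
  weakly_noetherian (meet_semigroup Y) <->
  weakly_right_noetherian (meet_semigroup Y).
Proof.
have mulC (x y : meet_semigroup Y) : x * y = y * x by exact: meetC.
split=> [[]//|wr]; split=> // I lI.
have [|X [fX XI gX]] := wr I; first by move=> x s Ix; rewrite mulC; apply: lI.
exists X; split=> //; rewrite {1}gX; congr (_ `|` _).
apply/seteqP; split=> z [x Hx [s Hs <-]];
  by exists s => //; exists x => //; rewrite mulC.
Qed.

Lemma finite_subsemilattice (A : set Y) : finite_set A ->
  exists B : set Y, [/\ finite_set B, subsemilattice B & A `<=` B].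
Proof.
move=> /finite_seqP[s ->]; elim: s => [|x s [B [fB sB sub]]].
  by exists set0; split=> // a /=; rewrite in_nil.
(* By commutativity and idempotence, one factor [x] is enough in any meet. *)
exists (B `|` ([set x] `|` [set (x `&` b)%O | b in B])); split.
- by rewrite !finite_setU; do !split=> //; exact: finite_image.
- move=> a b [Ba|[->|[a' Ba <-]]] [Bb|[->|[b' Bb <-]]].
  + by left; apply: sB.
  + by right; right; exists a => //; rewrite meetC.
  + by right; right; exists (a `&` b')%O; [exact: sB|rewrite meetCA].
  + by right; right; exists b.
  + by right; left; rewrite meetxx.
  + by right; right; exists b' => //; rewrite meetA meetxx.
  + by right; right; exists (a' `&` b)%O; [exact: sB|rewrite meetA].
  + by right; right; exists a' => //; rewrite meetAC meetxx.
  + by right; right; exists (a' `&` b')%O; [exact: sB|rewrite meetACA meetxx].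
- move=> a /=; rewrite in_cons => /orP[/eqP->|/sub]; first by right; left.
  by left.
Qed.

Lemma subsemilattice_finite_lbound (A B : set Y) (b : Y) :
  finite_set A -> A !=set0 -> A `<=` B -> subsemilattice B -> lbound A b ->
  exists c, [/\ B c, (b <= c)%O & lbound A c].
Proof.
move=> /finite_seqP[s ->] [x sx] sub sB lbb.
suff [c [Bc bc lc]] : exists c,
    [/\ B c, (b <= c)%O & {in s, forall a, c <= a}%O].
  by exists c.
have [Bx bx] : B x /\ (b <= x)%O by split; [exact: sub|exact: lbb].
have {lbb} : {in s, forall a, B a /\ (b <= a)%O}.
  by move=> a sa; split; [exact: sub|exact: lbb].
(* [x] stands for the empty meet, since [Y] may have no top. *)
elim: s {sub sx} => [|y s IHs] lbs; first by exists x.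
have [By b_y] := lbs y (mem_head y s).
have [a sa|c [Bc bc lc]] := IHs; first by apply: lbs; rewrite in_cons sa orbT.
exists (c `&` y)%O; split; first exact: sB.
  by rewrite lexI bc.
move=> a; rewrite in_cons => /orP[/eqP->|/lc]; first exact: leIr.
exact/le_trans/leIl.
Qed.

End Semilattice.

(** * Principal right ideals of S read off in S/R *)

Section RightIdeals.
Context {d : Order.disp_t} {Y : meetSemilatticeType d}.
Variables (T : strong_semilattice Y)
  (cT : forall a : Y, completely_simple (T a)).
Local Notation S := (strong_union T).
Local Notation D := (R_decomposition cT).

Definition R_class {a : Y} (u : T a) : D a := \pi_(R_component cT a) u.

Definition R_repr {a : Y} (p : D a) : T a := repr (p : R_component cT a).

Lemma R_reprK {a : Y} (p : D a) : R_class (R_repr p) = p.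
Proof. exact: reprK. Qed.

Lemma connecting_R_class {a b : Y} (ba : (b <= a)%O) (u : T a) :
  connecting D ba (R_class u) = R_class (connecting T ba u).
Proof. exact: R_connect_pi. Qed.

Lemma union_principalP {a b : Y} (u : T a) (v : T b) :
  principal_right (Defs.inj u) (Defs.inj v) <->
  exists ba : (b <= a)%O, connecting D ba (R_class u) = R_class v.
Proof.
split=> [/union_principal[ba uv]|[ba]].
  exists ba; rewrite connecting_R_class; apply/(eqquotP (R_component cT b)).
  exact/completely_simple_principal_greenR.
rewrite connecting_R_class => /(eqquotP (R_component cT b)) uv.
apply: (principal_union cT (ba := ba)).
exact/completely_simple_principal_greenR.
Qed.

Lemma union_principal_connecting {a b : Y} (ba : (b <= a)%O) (u : T a) :
  principal_right (Defs.inj u) (Defs.inj (connecting T ba u)).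
Proof. by apply/union_principalP; exists ba; rewrite connecting_R_class. Qed.

(** * Necessity of the three conditions *)

Lemma noetherian_index :
  weakly_right_noetherian S -> weakly_right_noetherian (meet_semigroup Y).
Proof.
move=> /weakly_right_noetherianP wn; apply/weakly_right_noetherianP => J rJ.
have [|X [fX XJ gX]] := wn [set z : S | J (tag z)].
  by move=> z s Jz; apply: rJ.
exists [set (tag z : meet_semigroup Y) | z in X]; split.
- exact: finite_image.
- by move=> _ [z /XJ Jz <-].
move=> b Jb; have [v _] := completely_simple_inhabited (cT b).
have [[a u] Xu /union_principalP[ba _]] := gX (Defs.inj v) Jb.
by exists a; [exists (Defs.inj u)|apply/meet_principalP].
Qed.

Lemma noetherian_component (a : Y) :
  weakly_right_noetherian S -> finite_set [set: D a].
Proof.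
move=> /weakly_right_noetherianP wn.
have [|X [fX XI gX]] := wn [set z : S | (tag z <= a)%O].
  by move=> z s; apply: le_trans; exact: leIl.
have [u0 _] := completely_simple_inhabited (cT a).
(* Generators have index at most [a], so only those of index [a] reach level [a]. The connecting map
   replaces a cast along that equality; the class of [u0] is a mere default. *)
pose f (z : S) : D a := if pselect (a <= tag z)%O is left az
  then connecting D az (R_class (tagged z)) else R_class u0.
apply: (sub_finite_set _ (finite_image f fX)) => p _.
have [[b u] Xu /union_principalP[ab]] := gX (Defs.inj (R_repr p)) (lexx a).
rewrite R_reprK => uv.
exists (Defs.inj u) => //; rewrite /f; case: pselect => [ab'|[]//].
by rewrite (bool_irrelevance ab' ab).
Qed.

Lemma noetherian_surjective_indices :
  weakly_right_noetherian S ->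
  exists Y0 : set Y, [/\ finite_set Y0, subsemilattice Y0 &
    forall b : Y, exists a : Y, Y0 a /\
      exists ba : (b <= a)%O,
        set_surj [set: D a] [set: D b] (connecting D ba)].
Proof.
move=> /weakly_right_noetherianP /(_ setT) [//|X [fX _ gX]].
pose X_tags := [set tag z | z in X].
have fX_tags : finite_set X_tags by exact: finite_image.
have [Y0 [fY0 sY0 XY0]] := finite_subsemilattice _ fX_tags.
exists Y0; split=> // b; pose A := [set a | X_tags a /\ (b <= a)%O].
have [||||a [Y0a ba lba]] := subsemilattice_finite_lbound A Y0 b _ _ _ sY0.
- by apply: sub_finite_set fX_tags => a [].
- have [v _] := completely_simple_inhabited (cT b).
  have [[a u] Xu /union_principalP[ba _]] := gX (Defs.inj v) I.
  by exists a; split=> //; exists (Defs.inj u).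
- by move=> a [/XY0].
- by move=> a [].
exists a; split=> //; exists ba => q _.
have [[c u] Xu /union_principalP[bc]] := gX (Defs.inj (R_repr q)) I.
rewrite R_reprK => uv.
(* Hence the map from level [c] to level [b] factors through level [a]. *)
have ac : (a <= c)%O by apply: lba; split=> //; exists (Defs.inj u).
exists (connecting D ac (R_class u)) => //.
by rewrite (connect_comp _ _ bc).
Qed.

(** * Sufficiency *)

Lemma noetherian_sufficient (Y0 : set Y) :
  weakly_right_noetherian (meet_semigroup Y) ->
  (forall a : Y, finite_set [set: D a]) -> finite_set Y0 ->
  (forall b : Y, exists a : Y, Y0 a /\ exists ba : (b <= a)%O,
    set_surj [set: D a] [set: D b] (connecting D ba)) ->
  weakly_right_noetherian S.
Proof.
move=> /weakly_right_noetherianP wnY fD fY0 surj.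
apply/weakly_right_noetherianP => I rI.
(* Meeting with [tag z] defines the image of [z] for every [b], so that the [b] with [g z b] in [I]
   form an ideal of [Y]. *)
pose g (z : S) (b : Y) : S :=
  Defs.inj (connecting T (leIl (tag z) b) (tagged z)).
have gP (z : S) (b c : Y) : (c <= b)%O -> principal_right (g z b) (g z c).
  move=> cb; have le : (tag z `&` c <= tag z `&` b)%O by apply: leI2.
  rewrite /g -(connect_comp (leIl (tag z) b) le).
  exact: union_principal_connecting.
have /choice[Z ZP] (z : S) : exists Z : set Y,
    [/\ finite_set Z, forall b, Z b -> I (g z b) &
     forall c, I (g z c) -> exists2 b, Z b & (c <= b)%O].
  have [|Z [fZ ZI gZ]] := wnY [set b : meet_semigroup Y | I (g z b)].
    by move=> b s /= Ib; apply: right_ideal_principal rI Ib (gP _ _ _ (leIl _ _)).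
  exists Z; split=> // c /gZ[b Zb /meet_principalP cb].
  by exists b.
(* One representative per R-class suffices, right ideals being unions of R-classes. *)
exists (\bigcup_(a in Y0) \bigcup_(p in [set: D a])
  [set g (Defs.inj (R_repr p)) b | b in Z (Defs.inj (R_repr p))]).
split.
- apply: bigcup_finite => // a _; apply: bigcup_finite => // p _.
  by apply: finite_image; case: (ZP (Defs.inj (R_repr p))).
- move=> _ [a _ [p _ [b + <-]]].
  by case: (ZP (Defs.inj (R_repr p))) => _ + _; apply.
move=> [b v] Iv; have [a [Y0a [ba /(_ (R_class v) Logic.I) [p _ pv]]]] := surj b.
set z : S := Defs.inj (R_repr p).
have ab : (b <= a `&` b)%O by rewrite lexI ba lexx.
(* The index of [g z b] is the meet of [a] and [b], equal but not convertible to [b]; two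
   containments express that [v] and [g z b] are R-related. *)
have [vg gv] : principal_right (Defs.inj v) (g z b) /\
    principal_right (g z b) (Defs.inj v).
  split; apply/union_principalP.
    exists (leIr b a); rewrite -pv -connecting_R_class R_reprK; exact: connect_comp.
  by exists ab; rewrite -pv -connecting_R_class R_reprK; exact: connect_comp.
(* Some [c] in [Z z] is above [b], so [g z c] generates [g z b] and hence [v]. *)
have [_ _ /(_ b)[]] := ZP z; first exact: right_ideal_principal rI Iv vg.
move=> c Zc bc; exists (g z c); first by exists a => //; exists p => //; exists c.
have Igc : principal_right (g z c) (g z b) by exact: gP.
exact: (right_ideal_principal (@principal_right_ideal _ _) Igc gv).
Qed.

End RightIdeals.

Theorem theorem7p15 (d : Order.disp_t) (Y : meetSemilatticeType d)
    (T : strong_semilattice Y) (cT : forall a : Y, completely_simple (T a)) :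
  let S := strong_union T in
  let D := R_decomposition cT in
  weakly_right_noetherian S <->
  [/\ weakly_noetherian (meet_semigroup Y),
      forall a : Y, finite_set [set: D a] &
      exists Y0 : set Y, [/\ finite_set Y0, subsemilattice Y0 &
        forall b : Y, exists a : Y, Y0 a /\
          exists ba : (b <= a)%O,
            set_surj [set: D a] [set: D b] (connecting D ba)]].
Proof.
move=> S D; split=> [wn|[/meet_weakly_noetherian wnY fD [Y0 [fY0 _ surj]]]].
  split; first exact/meet_weakly_noetherian/noetherian_index.
  - by move=> a; exact: noetherian_component.
  - exact: noetherian_surjective_indices.
exact: noetherian_sufficient wnY fD fY0 surj.
Qed.
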